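(* Let $\mathcal{T}_0$ be a theory with signature $\Pi_0 = (\Sigma_0, \mathsf{Pred})$ and $\mathcal{T} = \mathcal{T}_0 \cup \mathcal{K}$ an extension by new function symbols $\Sigma_1$, where $\mathcal{K}$ is a set of $\Sigma_1$-flat clauses. Let $\Psi_{\mathcal{K}}$ be a term closure operator which additionally satisfies: for every set $T$ of ground terms and every clause $D \in \mathcal{K}$, if a variable occurs in two terms of $D$ starting with function symbols in $\Sigma_1$, then either the two terms are identical, or the variable occurs below two different unary function symbols $f$ and $g$ and, for every constant $c$, $f(c) \in \Psi_{\mathcal{K}}(T)$ iff $g(c) \in \Psi_{\mathcal{K}}(T)$. If the extension $\mathcal{T}_0 \subseteq \mathcal{T}$ satisfies condition $(\mathsf{Emb}^{\Psi}_w)$, then it satisfies condition $(\mathsf{Loc}^{\Psi}_f)$ (i.e. it is $\Psi$-local).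
   Context: Signature $\Pi = (\Sigma_0 \cup \Sigma_1, \mathsf{Pred})$; $C$ is a set of additional constants. A non-ground clause is $\Sigma_1$-flat if no function symbol (including constants) occurs as an argument of a function symbol in $\Sigma_1$. For a set $G$ of ground clauses, $\mathrm{est}(\mathcal{K}, G)$ is the set of ground terms starting with a $\Sigma_1$-symbol occurring in $G$ or $\mathcal{K}$. For a set $T$ of ground terms, $\mathcal{K}[T]$ is the set of instances of clauses of $\mathcal{K}$ in which all terms starting with a $\Sigma_1$-symbol belong to $T$; $\mathcal{K}[\Psi_{\mathcal{K}}(G)]$ denotes $\mathcal{K}[\Psi_{\mathcal{K}}(\mathrm{est}(\mathcal{K}, G))]$. Term closure operator: a map $\Psi_{\mathcal{K}}$ on sets of ground terms such that for all $T, T'$: (i) $\mathrm{est}(\mathcal{K}, T) \subseteq \Psi_{\mathcal{K}}(T)$; (ii) $T \subseteq T'$ implies $\Psi_{\mathcal{K}}(T) \subseteq \Psi_{\mathcal{K}}(T')$; (iii) $\Psi_{\mathcal{K}}(\Psi_{\mathcal{K}}(T)) \subseteq \Psi_{\mathcal{K}}(T)$; (iv) for every map $h : C \to C$, $\bar h(\Psi_{\mathcal{K}}(T)) = \Psi_{\mathcal{K}}(\bar h(T))$, where $\bar h$ is the canonical extension of $h$ to extension ground terms. $(\mathsf{Loc}^{\Psi}_f)$: for every finite set $G$ of ground $\Pi^C$-clauses, $\mathcal{T}_0 \cup \mathcal{K} \cup G \models \bot$ iff $\mathcal{T}_0 \cup \mathcal{K}[\Psi_{\mathcal{K}}(G)]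 \cup G$ is unsatisfiable. Partial structures: a partial $\Pi$-structure has a nonempty support $A$, partial functions $f_{\mathcal{A}}: A^n \rightharpoonup A$ and relations $p_{\mathcal{A}} \subseteq A^m$; term evaluation under an assignment $\beta$ is undefined if some subterm evaluation is undefined. $(\mathcal{A}, \beta) \models_w D$ (weak partial model of a clause $D$) if some term of $D$ is undefined under $\beta$, or all are defined and some literal of $D$ holds; $\mathcal{A}$ weakly satisfies $D$ if this holds for all $\beta$. A weak $\Pi$-homomorphism $h: \mathcal{A} \to \mathcal{B}$ is a total map such that whenever $f_{\mathcal{A}}(a_1, \dots, a_n)$ is defined, $f_{\mathcal{B}}(h(a_1), \dots, h(a_n))$ is defined and equals $h(f_{\mathcal{A}}(a_1, \dots, a_n))$. $\mathcal{A}$ weakly embeds into $\mathcal{B}$ if there is an injective weak homomorphism $h$ with $p_{\mathcal{A}}(\overline{a})$ iff $p_{\mathcal{B}}(h(\overline{a}))$ for all predicates $p$. $\mathsf{PMod}^{\Psi}_w(\Sigma_1, \mathcal{T})$: the class of partial $\Pi$-structures $\mathcal{A}$ in which all $\Sigma_0$-functions are total, the $\Pi_0$-reduct is a model of $\mathcal{T}_0$, the $\Sigma_1$-functions are partial, $\mathcal{A}$ weakly satisfies all clauses in $\mathcal{K}$, and the set $\mathrm{Def}(\mathcal{A}) = \{ f(a_1, \dots, a_n) \mid a_i \in A, f_{\mathcal{A}}(a_1, \dots, a_n) \text{ defined}\}$ (elements of $A$ viewed as constants) is closed under $\Psi_{\mathcal{K}}$. $(\mathsf{Emb}^{\Psi}_w)$: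 every $\mathcal{A} \in \mathsf{PMod}^{\Psi}_w(\Sigma_1, \mathcal{T})$ weakly embeds into a total model of $\mathcal{T}$.
   Formalization: Added: no term of K starting with a Σ1-symbol contains a variable twice; Ψ is defined for every set of constants, commutes with all maps between such sets, and treats arguments of Σ1-terms (also compound ground terms) as constants. Without these the claim has counterexamples. *)

(* Defs.v *)
From Stdlib Require List.
From mathcomp Require Import all_boot.
From mathcomp Require Import classical_sets.

Set Implicit Arguments.
Unset Strict Implicit.
Unset Printing Implicit Defensive.

Local Open Scope classical_set_scope.

(** * Signatures, terms, clauses, first-order formulas *)

(* Function symbols or predicate symbols, with their arities. *)
Record symbols := Symbols { sym :> Type; ar : sym -> nat }.

Definition ssum (F F' : symbols) : symbols :=
  @Symbols (F + F')%type
    (fun s => match s with inl f => ar f | inr f => ar f end).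

Definition consts (C : Type) : symbols := @Symbols C (fun=> 0).

Inductive term (F : symbols) (V : Type) : Type :=
| Var of V
| App (f : F) of ('I_(ar f) -> term F V).
Arguments Var {F V}.
Arguments App {F V}.

Definition gterm (F : symbols) := term F void.

Fixpoint gincl (F : symbols) (V : Type) (t : gterm F) : term F V :=
  match t with
  | Var v => match v with end
  | App f ts => App f (fun i => gincl V (ts i))
  end.

(* Apply a substitution whose values may use the additional symbols [F']. *)
Fixpoint inst (F F' : symbols) (V W : Type) (s : V -> term (ssum F F') W)
    (t : term F V) : term (ssum F F') W :=
  match t with
  | Var v => s v
  | App f ts => @App (ssum F F') W (inl f) (fun i => inst s (ts i))
  end.

Inductive atom (F P : symbols) (V : Type) : Type :=
| Eq of term F V & term F V
| Rel (p : P) of ('I_(ar p) -> term F V).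
Arguments Eq {F P V}.
Arguments Rel {F P V}.

(* [(true, a)] is the literal [a], [(false, a)] its negation. *)
Definition literal (F P : symbols) (V : Type) := (bool * atom F P V)%type.

Definition clause (F P : symbols) (V : Type) := seq (literal F P V).

Definition ainst (F F' P : symbols) (V W : Type)
    (s : V -> term (ssum F F') W) (a : atom F P V) : atom (ssum F F') P W :=
  match a with
  | Eq t u => Eq (inst s t) (inst s u)
  | Rel p ts => Rel p (fun i => inst s (ts i))
  end.

Definition cinst (F F' P : symbols) (V W : Type)
    (s : V -> term (ssum F F') W) (D : clause F P V) : clause (ssum F F') P W :=
  [seq (l.1, ainst s l.2) | l <- D].

Definition clift (F F' P : symbols) (V : Type) (D : clause F P V) :
  clause (ssum F F') P V := cinst Var D.

Inductive subterm (F : symbols) (V : Type) (s : term F V) : term F V -> Prop :=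
| Sub_refl : subterm s s
| Sub_arg f ts i : subterm s (ts i) -> subterm s (App f ts).

Definition atom_term (F P : symbols) (V : Type) (a : atom F P V) (t : term F V)
    : Prop :=
  match a with
  | Eq u v => t = u \/ t = v
  | Rel p ts => exists i, t = ts i
  end.

Definition occurs (F P : symbols) (V : Type) (s : term F V) (D : clause F P V)
    : Prop :=
  exists l t, [/\ List.In l D, atom_term l.2 t & subterm s t].

Inductive formula (F P : symbols) : Type :=
| FAtom of atom F P nat
| FFalse
| FImp of formula F P & formula F P
| FAll of nat & formula F P.

(* Free variables of axioms are read as universally quantified. *)
Definition theory (F P : symbols) := set (formula F P).

(** * Total structures *)

Record structure (F P : symbols) := Structure {
  carrier :> Type;
  carrier_inh : inhabited carrier;
  fint : forall f : F, ('I_(ar f) -> carrier) -> carrier;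
  pint : forall p : P, ('I_(ar p) -> carrier) -> Prop }.

Definition reductl (F F' P : symbols) (M : structure (ssum F F') P) :
    structure F P :=
  Structure (carrier_inh M) (fun f : F => @fint _ _ M (inl f)) (@pint _ _ M).

Section Semantics.
Context (F P : symbols) (M : structure F P).

Fixpoint eval (V : Type) (b : V -> M) (t : term F V) : M :=
  match t with
  | Var v => b v
  | App f ts => fint (fun i => eval b (ts i))
  end.

Definition asat (V : Type) (b : V -> M) (a : atom F P V) : Prop :=
  match a with
  | Eq t u => eval b t = eval b u
  | Rel p ts => pint (fun i => eval b (ts i))
  end.

Definition lsat (V : Type) (b : V -> M) (l : literal F P V) : Prop :=
  if l.1 then asat b l.2 else ~ asat b l.2.

Definition csat (V : Type) (D : clause F P V) : Prop :=
  forall b : V -> M, exists2 l, List.In l D & lsat b l.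

Fixpoint fsat (b : nat -> M) (phi : formula F P) : Prop :=
  match phi with
  | FAtom a => asat b a
  | FFalse => False
  | FImp phi1 phi2 => fsat b phi1 -> fsat b phi2
  | FAll x phi1 => forall a : M, fsat (fun y => if y == x then a else b y) phi1
  end.

Definition models (T : theory F P) : Prop :=
  forall phi, T phi -> forall b, fsat b phi.

End Semantics.

(** * Partial structures *)

Record pstructure (F P : symbols) := PStructure {
  pcarrier :> Type;
  pcarrier_inh : inhabited pcarrier;
  pfint : forall f : F, ('I_(ar f) -> pcarrier) -> option pcarrier;
  ppint : forall p : P, ('I_(ar p) -> pcarrier) -> Prop }.

Definition partial_of (F P : symbols) (M : structure F P) : pstructure F P :=
  PStructure (carrier_inh M) (fun f a => Some (@fint _ _ M f a)) (@pint _ _ M).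

Section PartialSemantics.
Context (F P : symbols) (A : pstructure F P) (V : Type) (b : V -> A).

(* [peval t a]: the value of [t] is defined and equal to [a]. *)
Inductive peval : term F V -> A -> Prop :=
| PE_var v : peval (Var v) (b v)
| PE_app f ts xs a :
    (forall i, peval (ts i) (xs i)) -> pfint xs = Some a -> peval (App f ts) a.

Definition pasat (a : atom F P V) : Prop :=
  match a with
  | Eq t u => exists2 x, peval t x & peval u x
  | Rel p ts => exists2 xs, forall i, peval (ts i) (xs i) & ppint xs
  end.

Definition wsat (D : clause F P V) : Prop :=
  (exists2 t, occurs t D & ~ exists a, peval t a) \/
  ((forall t, occurs t D -> exists a, peval t a) /\
   exists2 l, List.In l D & if l.1 then pasat l.2 else ~ pasat l.2).

End PartialSemantics.

Definition weak_model (F P : symbols) (A : pstructure F P) (V : Type)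
  (D : clause F P V) : Prop := forall b : V -> A, wsat b D.

Definition weak_hom (F P : symbols) (A B : pstructure F P) (h : A -> B) : Prop :=
  forall (f : F) (xs : 'I_(ar f) -> A) a,
    pfint xs = Some a -> pfint (h \o xs) = Some (h a).

Definition weakly_embeds (F P : symbols) (A B : pstructure F P) : Prop :=
  exists h : A -> B, [/\ weak_hom h, injective h &
    forall (p : P) (xs : 'I_(ar p) -> A), ppint xs <-> ppint (h \o xs)].

(** * Extension terms and term closure operators *)

(* Extension terms f(x_1, ..., x_n), f in [F1], whose arguments are taken from a
   set [X] of constants.  Three instances of [X] matter: the constants [C],
   the support of a partial structure (whose elements are viewed as constants),
   and the set of ground terms, which gives all ground terms with head in
   [F1]. *)
Record xterm (F1 : symbols) (X : Type) := XTerm {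
  xhead : F1;
  xargs : 'I_(ar xhead) -> X }.
Arguments XTerm {F1 X}.

Definition xmap (F1 : symbols) (X Y : Type) (h : X -> Y) (s : xterm F1 X) :
  xterm F1 Y := XTerm (xhead s) (h \o @xargs _ _ s).

Section Extension.
Context (F0 F1 P : symbols).

Definition Pi : symbols := ssum F0 F1.
Definition PiC (C : Type) : symbols := ssum Pi (consts C).

Definition eterm (V : Type) (f : F1) (ts : 'I_(ar f) -> term Pi V) :
  term Pi V := @App Pi V (inr f) ts.

Definition etermC (C V : Type) (s : xterm F1 (term (PiC C) V)) :
  term (PiC C) V := @App (PiC C) V (inl (inr (xhead s))) (@xargs _ _ s).

Definition xcst (C V : Type) (c : C) : term (PiC C) V :=
  @App (PiC C) V (inr c) (fun i => match notF (ltn_ord i) with end).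

Context (T0 : theory F0 P) (K : set (clause Pi P nat)).

Definition flat : Prop :=
  forall D, K D -> forall (f : F1) ts, occurs (@eterm nat f ts) D ->
  forall i, exists v, ts i = Var v.

(* Second half of the usual linearity condition; [shared_variables] below only
   compares different terms.  With K = {~ Q(f(x,x))} and Psi = est it cannot be
   dropped: {Q(f(c,d)), c = d} has no instance in K[Psi(G)]. *)
Definition no_repeated_variable : Prop :=
  forall D, K D -> forall (f : F1) ts, occurs (@eterm nat f ts) D ->
  forall i j v, ts i = Var v -> ts j = Var v -> i = j.

(* est(K, T) for a set T of extension terms with arguments in [X]; a term with
   such arguments has no proper subterm with head in [F1]. *)
Definition estX (X : Type) (T : set (xterm F1 X)) : set (xterm F1 X) :=
  T `|` [set s | exists2 D, K D &
           occurs (etermC (xmap (@xcst X nat) s)) (clift (consts X) D)].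

Definition est (C : Type) (G : seq (clause (PiC C) P void)) :
    set (xterm F1 (gterm (PiC C))) :=
  [set s | (exists2 D, List.In D G & occurs (etermC s) D) \/
           (exists2 D, K D &
              occurs (gincl nat (etermC s)) (clift (consts C) D))].

(* Instances need not be ground: a variable that is not below a symbol of [F1]
   may stay a variable. *)
Definition instances (C : Type) (T : set (xterm F1 (gterm (PiC C)))) :
    set (clause (PiC C) P nat) :=
  [set D' | exists2 D, K D & exists2 s, D' = cinst s D &
     forall u : xterm F1 (term (PiC C) nat), occurs (etermC u) D' ->
       exists2 g, T g & u = xmap (@gincl _ nat) g].

Context (Psi : forall X : Type, set (xterm F1 X) -> set (xterm F1 X)).

(* [Psi] is applied both to ground terms and to [Def A], so it is given
   uniformly in the set of constants, and [psi_map] covers maps between two such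
   sets (in particular every h : C -> C). *)
Record term_closure : Prop := TermClosure {
  psi_est : forall X T, estX T `<=` @Psi X T;
  psi_mono : forall X T T', T `<=` T' -> @Psi X T `<=` @Psi X T';
  psi_idem : forall X T, @Psi X (@Psi X T) `<=` @Psi X T;
  psi_map : forall (X Y : Type) (h : X -> Y) T,
    xmap h @` @Psi X T = @Psi Y (xmap h @` T) }.

Definition shared_variables : Prop :=
  forall (X : Type) (T : set (xterm F1 X)) D, K D ->
  forall (v : nat) (f g : F1) ts us,
    occurs (@eterm nat f ts) D -> occurs (@eterm nat g us) D ->
    subterm (Var v) (@eterm nat f ts) -> subterm (Var v) (@eterm nat g us) ->
    @eterm nat f ts = @eterm nat g us \/
    [/\ f <> g, ar f = 1, ar g = 1 &
        forall c : X, Psi T (XTerm f (fun=> c)) <-> Psi T (XTerm g (fun=> c))].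

Definition satisfiable (C : Type) (N : set (clause (PiC C) P nat))
    (G : seq (clause (PiC C) P void)) : Prop :=
  exists M : structure (PiC C) P,
    [/\ models (reductl (reductl M)) T0,
        forall D, N D -> csat M D &
        forall D, List.In D G -> csat M D].

Definition Loc (C : Type) : Prop :=
  forall G : seq (clause (PiC C) P void),
    ~ satisfiable [set clift (consts C) D | D in K] G <->
    ~ satisfiable (instances (Psi (est G))) G.

Definition Def (A : pstructure Pi P) : set (xterm F1 A) :=
  [set s | exists a, @pfint Pi P A (inr (xhead s)) (@xargs _ _ s) = Some a].

Definition PMod (A : pstructure Pi P) : Prop :=
  [/\ exists f0 : forall f : F0, ('I_(ar f) -> A) -> A,
        (forall f xs, @pfint Pi P A (inl f) xs = Some (f0 f xs)) /\
        models (Structure (pcarrier_inh A) f0 (@ppint _ _ A)) T0,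
      forall D, K D -> weak_model A D &
      Psi (@Def A) `<=` @Def A].

Definition total_model (B : structure Pi P) : Prop :=
  models (reductl B) T0 /\ forall D, K D -> csat B D.

Definition Emb : Prop :=
  forall A : pstructure Pi P, PMod A ->
  exists2 B : structure Pi P, total_model B & weakly_embeds A (partial_of B).

End Extension.

(* Main.v *)
Require Import Defs.
From mathcomp Require Import all_boot.
From mathcomp Require Import boolp classical_sets.

(** Let [M] be a model of T0, of K[Psi(G)] and of [G].  Keep the functions of
    [F1] only at the values in [M] of the argument tuples of Psi(est(K, G)).
    Since Psi commutes with maps of constants, here evaluation in [M], the
    domain of definition is Psi-closed.  If all terms of a clause [D] of K are
    defined under an assignment, flatness and the conditions on shared variables
    let one choose ground terms with the same values for the variables below
    [F1] so that the resulting instance of [D] lies in K[Psi(G)]; thus the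
    partial structure weakly satisfies K.  A total model of T0 and K into which
    it weakly embeds satisfies [G], all of whose terms are defined. *)

Set Implicit Arguments.
Unset Strict Implicit.
Unset Printing Implicit Defensive.

Local Open Scope classical_set_scope.

(** * Terms and substitutions *)

Section Terms.
Context (F0 F1 P : symbols).
Local Notation Pi := (Pi F0 F1).
Local Notation PiC := (PiC F0 F1).

(** The tuple of [s] is retyped over the head of [u], so that arguments can be compared index by
    index without casts. *)
Lemma xmap_eq (X Y : Type) (h : X -> Y) (s : xterm F1 X) (u : xterm F1 Y) :
  xmap h s = u ->
  exists2 xs, s = XTerm (xhead u) xs & forall i, h (xs i) = xargs i.
Proof. by move=> <-; case: s => f xs; exists xs. Qed.

Lemma xmap_args (X Y : Type) (h : X -> Y) (f : F1) (xs : 'I_(ar f) -> X)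
    (ys : 'I_(ar f) -> Y) :
  (forall i, h (xs i) = ys i) -> xmap h (XTerm f xs) = XTerm f ys.
Proof. by move=> e; rewrite /xmap /=; congr XTerm; apply/funext. Qed.

Lemma subterm_trans (F : symbols) (V : Type) (s t u : term F V) :
  subterm s t -> subterm t u -> subterm s u.
Proof. by move=> st; elim=> // f ts i _ IH; apply: Sub_arg IH. Qed.

Lemma occurs_sub (F Q : symbols) (V : Type) (s t : term F V) (D : clause F Q V) :
  subterm s t -> occurs t D -> occurs s D.
Proof.
by move=> st [l [r [lD rl tr]]]; exists l, r; split=> //; apply: subterm_trans tr.
Qed.

(** Applied to both sides of an equation between terms, this partial projection separates the heads
    and replaces a dependent inversion of [App]. *)
Definition xterm_of (C V : Type) (t : term (PiC C) V) :
    option (xterm F1 (term (PiC C) V)) :=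
  match t with
  | App (inl (inr f)) ts => Some (XTerm f ts)
  | _ => None
  end.


Definition xterm_ofP (V : Type) (t : term Pi V) : option (xterm F1 (term Pi V)) :=
  match t with
  | App (inr f) ts => Some (XTerm f ts)
  | _ => None
  end.

Lemma eterm_inj (V : Type) (u u' : xterm F1 (term Pi V)) :
  eterm (@xargs _ _ u) = eterm (@xargs _ _ u') -> u = u'.
Proof. by case: u u' => [f xs] [g ys] /(congr1 (@xterm_ofP V)) /Some_inj. Qed.

Lemma subterm_inv (F : symbols) (V : Type) (s t : term F V) :
  subterm s t ->
  match t with
  | Var _ => s = t
  | App f ts => s = t \/ exists i, subterm s (ts i)
  end.
Proof. by case=> [|f ts i si]; [case: s => *; [|left]|right; exists i]. Qed.

Lemma subterm_gincl (F : symbols) (V : Type) (s : term F V) (t : gterm F) :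
  subterm s (gincl V t) -> exists2 t0, subterm t0 t & s = gincl V t0.
Proof.
elim: t => [[]|f ts IH] /= /subterm_inv [->|[i /IH[t0 t0i ->]]].
  by exists (App f ts) => //; apply: Sub_refl.
by exists t0 => //; apply: Sub_arg t0i.
Qed.

Lemma etermC_gincl (C V : Type) (u : xterm F1 (term (PiC C) V)) (t : gterm (PiC C)) :
  etermC u = gincl V t ->
  exists2 g : xterm F1 (gterm (PiC C)), t = etermC g & u = xmap (@gincl _ V) g.
Proof.
case: t => [[]|[[f|f]|c] ts] e; have := congr1 (@xterm_of C V) e => //=.
by case: u {e} => g us /= /Some_inj ->; exists (XTerm f ts).
Qed.

Lemma subterm_inst (C V W : Type) (s : V -> term (PiC C) W)
    (u : xterm F1 (term (PiC C) W)) (t : term Pi V) :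
  subterm (etermC u) (inst s t) ->
  (exists2 u0 : xterm F1 (term Pi V), subterm (eterm (@xargs _ _ u0)) t &
     u = xmap (inst s) u0) \/
  (exists2 v, subterm (Var v) t & subterm (etermC u) (s v)).
Proof.
elim: t => [v|f ts IH] /=.
  by right; exists v => //; apply: Sub_refl.
move=> /subterm_inv [e|[i ui]].
  case: f ts {IH} e => f ts e; have := congr1 (@xterm_of C W) e => //=.
  case: u {e} => g us /= /Some_inj ->; left; exists (XTerm f ts) => //.
  exact: Sub_refl.
by have [[w wi ->]|[v vi vu]] := IH i ui; [left; exists w|right; exists v];
  rewrite //; apply: Sub_arg; eassumption.
Qed.

Lemma occurs_cinst (C V W : Type) (s : V -> term (PiC C) W)
    (u : xterm F1 (term (PiC C) W)) (D : clause Pi P V) :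
  occurs (etermC u) (cinst s D) ->
  (exists2 u0 : xterm F1 (term Pi V), occurs (eterm (@xargs _ _ u0)) D &
     u = xmap (inst s) u0) \/
  (exists2 v, occurs (Var v) D & subterm (etermC u) (s v)).
Proof.
move=> [l' [t' [/List.in_map_iff[[b a] [<- lD]] /= t'a ut']]].
have [t ta e] : exists2 t, atom_term a t & t' = inst s t.
  case: a t'a {lD} => [t1 t2|p ts] /=; last by move=> [i ->]; exists (ts i); [exists i|].
  by move=> [->|->]; [exists t1|exists t2] => //; [left|right].
rewrite {}e in ut'.
by have [[u0 u0t ->]|[v vt uv]] := subterm_inst ut'; [left; exists u0|right; exists v];
  rewrite //; exists (b, a), t.
Qed.

End Terms.

(** * Evaluation *)

Section Evaluation.
Context (P : symbols).

Lemma eval_inst (F F' : symbols) (M : structure (ssum F F') P) (V W : Type)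
    (s : V -> term (ssum F F') W) (b : W -> M) (t : term F V) :
  eval b (inst s t) = eval (M := reductl M) (fun v => eval b (s v)) t.
Proof. by elim: t => //= f ts IH; congr fint; apply/funext => i. Qed.

Lemma lsat_inst (F F' : symbols) (M : structure (ssum F F') P) (V W : Type)
    (s : V -> term (ssum F F') W) (b : W -> M) (l : literal F P V) :
  lsat b (l.1, ainst s l.2) = lsat (M := reductl M) (fun v => eval b (s v)) l.
Proof.
suff e : asat b (ainst s l.2) = asat (M := reductl M) (fun v => eval b (s v)) l.2.
  by rewrite /lsat /= e.
case: l.2 => [t u|p ts] /=; first by rewrite !eval_inst.
by congr pint; apply/funext => i; rewrite eval_inst.
Qed.

Lemma csat_cinst (F F' : symbols) (M : structure (ssum F F') P) (V W : Type)
    (s : V -> term (ssum F F') W) (D : clause F P V) (b : W -> M) :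
  (exists2 l, List.In l (cinst s D) & lsat b l) <->
  (exists2 l, List.In l D & lsat (M := reductl M) (fun v => eval b (s v)) l).
Proof.
split=> [[_ /List.in_map_iff[l [<- lD]]]|[l lD]].
  by rewrite lsat_inst; exists l.
by rewrite -lsat_inst => lb; exists (l.1, ainst s l.2) => //; apply/List.in_map_iff; exists l.
Qed.

Lemma csat_clift (F F' : symbols) (M : structure (ssum F F') P) (V : Type)
    (D : clause F P V) : csat M (clift F' D) <-> csat (reductl M) D.
Proof. by split=> h b; apply/(csat_cinst (M := M) Var D b); apply: h. Qed.

Lemma eval_gincl (F : symbols) (M : structure F P) (V : Type) (b : V -> M)
    (b0 : void -> M) (t : gterm F) : eval b (gincl V t) = eval b0 t.
Proof. by elim: t => [[]|f ts IH] /=; congr fint; apply/funext => i. Qed.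

End Evaluation.

(** * Restricting the extension functions of a total structure *)

Section Restriction.
Context (F0 F1 P : symbols) (M : structure (Pi F0 F1) P) (S : set (xterm F1 M)).

Definition prestrict : pstructure (Pi F0 F1) P :=
  PStructure (carrier_inh M)
    (fun f : Pi F0 F1 =>
       match f return ('I_(@ar (Pi F0 F1) f) -> M) -> option M with
       | inl f => fun xs => Some (@fint _ _ M (inl f) xs)
       | inr f => fun xs =>
           if `[< S (XTerm f xs) >] then Some (@fint _ _ M (inr f) xs)
           else None
       end)
    (@pint _ _ M).

Lemma Def_prestrict : @Def F0 F1 P prestrict = S.
Proof.
apply/seteqP; split=> [[f xs]|[f xs] Sx] /=.
  by move=> [a] /=; case: asboolP.
by eexists; rewrite /= (asboolT Sx).
Qed.

Lemma pfint_prestrict (f : Pi F0 F1) xs a :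
  @pfint _ _ prestrict f xs = Some a -> a = fint (s := M) xs.
Proof. by case: f xs => f xs /=; [|case: asboolP => // _]; case. Qed.

Lemma peval_prestrict (V : Type) (b : V -> M) t a :
  peval (A := prestrict) b t a -> a = eval b t.
Proof.
elim=> // {t a} f ts xs a _ IH /pfint_prestrict ->.
by congr fint; apply/funext.
Qed.

Lemma peval_eterm (V : Type) (b : V -> M) (f : F1) ts a :
  peval (A := prestrict) b (@eterm F0 F1 V f ts) a ->
  S (XTerm f (fun i => eval b (ts i))).
Proof.
(* Stated for an arbitrary term by cases on its head, the claim can be proved by case analysis on
   the derivation, with no equation between dependent tuples. *)
pose inv (t : term (Pi F0 F1) V) := match t with
  | App (inr g) us => S (XTerm g (fun i => eval b (us i)))
  | _ => True end.
suff inv_t t : peval (A := prestrict) b t a -> inv t by move/inv_t.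
case=> // -[//|g] us xs {}a usxs /=; case: asboolP => // Sx _.
suff -> : (fun i => eval b (us i)) = xs by [].
by apply/funext => i; rewrite -(peval_prestrict (usxs i)).
Qed.

(** An undefined term gives weak satisfaction at once. Otherwise all extension terms of [D] lie in
    the domain and partial evaluation agrees with total evaluation, so a true literal stays true. *)
Lemma wsat_prestrict (V : Type) (b : V -> M) (D : clause (Pi F0 F1) P V) :
  ((forall f ts, occurs (@eterm F0 F1 V f ts) D -> S (XTerm f (fun i => eval b (ts i)))) ->
   exists2 l, List.In l D & lsat b l) ->
  wsat (A := prestrict) b D.
Proof.
move=> satD.
have [[t tD nt]|/forall2NP alldef] := pselect (exists2 t, occurs t D &
    ~ exists a, peval (A := prestrict) b t a); first by left; exists t.
have {}alldef t : occurs t D -> exists a, peval (A := prestrict) b t a.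
  by case: (alldef t) => // /contrapT.
right; split=> //; have [|l lD lb] := satD.
  by move=> f ts /alldef[a /peval_eterm].
exists l => //.
have def t : atom_term l.2 t -> peval (A := prestrict) b t (eval b t).
  move=> tl; have [|a ta] := alldef t.
    by exists l, t; split=> //; apply: Sub_refl.
  by rewrite -(peval_prestrict ta).
suff e : pasat (A := prestrict) b l.2 <-> asat b l.2.
  by move: lb; rewrite /lsat; case: l.1 => [/e|nl /e].
case: l.2 def => [t u|p ts] /= def; split.
- by move=> [x /peval_prestrict <- /peval_prestrict].
- move=> tu; exists (eval b t); first by apply: def; left.
  by rewrite tu; apply: def; right.
- by move=> [xs xsE]; congr pint; apply/funext => i; apply/peval_prestrict.
- by move=> pts; exists (fun i => eval b (ts i)) => // i; apply: def; exists i.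
Qed.

End Restriction.

(** * Closure operators *)

Section Closure.
Context (F0 F1 P : symbols) (K : set (clause (Pi F0 F1) P nat)).
Context (Psi : forall X : Type, set (xterm F1 X) -> set (xterm F1 X)).
Hypothesis Psi_closure : term_closure K Psi.

Lemma psi_sub (X : Type) (T : set (xterm F1 X)) : T `<=` Psi T.
Proof. by move=> t Tt; apply: (psi_est Psi_closure); left. Qed.

(* Apply [psi_map] to the inclusion of the set of arguments of [T] in [X]. *)
Lemma psi_args (X : Type) (T : set (xterm F1 X)) (s : xterm F1 X) i :
  Psi T s -> exists2 s', T s' & exists j, @xargs _ _ s i = @xargs _ _ s' j.
Proof.
pose A x := exists2 s', T s' & exists j, x = @xargs _ _ s' j.
have TE : T = xmap (@proj1_sig X A) @` [set s' | T (xmap (@proj1_sig X A) s')].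
  apply/seteqP; split=> [[f xs] Tt|_ [s' ? <-] //].
  have xsA k : A (xs k) by exists (XTerm f xs) => //; exists k.
  have e : xmap (@proj1_sig X A) (XTerm f (fun k => exist A (xs k) (xsA k))) = XTerm f xs.
    exact: xmap_args.
  by exists (XTerm f (fun k => exist A (xs k) (xsA k))); rewrite /= e.
rewrite {1}TE -(psi_map Psi_closure) => -[s' _ es]; case: s / es i => /= i.
exact: proj2_sig (xargs i).
Qed.

Hypothesis K_flat : flat K.
Context (C : Type) (G : seq (clause (PiC F0 F1 C) P void)).

(** By flatness, any argument of a term coming from [K] would be a variable, which is impossible for
    a ground term. Hence only terms occurring in [G] have arguments, and there the claim is
    transitivity of subterms. *)
Lemma est_arg (s u : xterm F1 (gterm (PiC F0 F1 C))) i :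
  est K G s -> subterm (etermC u) (@xargs _ _ s i) -> est K G u.
Proof.
move=> [[D DG sD] us|[D KD]].
  by left; exists D => //; apply: occurs_sub sD; apply: Sub_arg us.
have -> : gincl nat (etermC s) = etermC (xmap (@gincl _ nat) s) by [].
move=> /occurs_cinst[[u0 u0D]|[v _ /= sv]].
  move=> /xmap_eq[xs es xsE]; rewrite {}es /= in i *.
  have [v ev] := K_flat KD u0D i.
  by have := xsE i; rewrite /= ev /=; case: (xs i) => [[]|].
by move: sv; move e: (Var v) => r sr; case: sr e.
Qed.

(** The closure may add extension terms, but their arguments are already arguments of terms in
    [est K G]. *)
Lemma psi_est_arg (s u : xterm F1 (gterm (PiC F0 F1 C))) i :
  Psi (est K G) s -> subterm (etermC u) (@xargs _ _ s i) -> Psi (est K G) u.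
Proof.
move=> /(psi_args i)[s' Ts' [j ->]] us'.
by apply: psi_sub; apply: est_arg us'.
Qed.

End Closure.

(** * Weak satisfaction of K *)

Section Locality.
Context (F0 F1 P : symbols) (C : Type).
Local Notation Pi := (Pi F0 F1).
Local Notation PiC := (PiC F0 F1).
Context (K : set (clause Pi P nat)).
Context (Psi : forall X : Type, set (xterm F1 X) -> set (xterm F1 X)).
Hypotheses (K_flat : flat K) (K_norep : no_repeated_variable K).
Hypotheses (Psi_closure : term_closure K Psi) (Psi_shared : shared_variables K Psi).
Context (G : seq (clause (PiC C) P void)) (M : structure (PiC C) P).

Definition gval (t : gterm (PiC C)) : M := eval (of_void M) t.

Definition gdefined : set (xterm F1 M) := xmap gval @` Psi (est K G).

Definition est_restrict : pstructure Pi P := prestrict (M := reductl M) gdefined.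

Lemma psi_gdefined : Psi gdefined `<=` gdefined.
Proof.
rewrite /gdefined (psi_map Psi_closure) => s; exact: (psi_idem Psi_closure).
Qed.

Lemma ground_substitution (D : clause Pi P nat) (b : nat -> M) :
  K D ->
  (forall f ts, occurs (@eterm F0 F1 nat f ts) D ->
     gdefined (XTerm f (fun i => eval (M := reductl M) b (ts i)))) ->
  exists2 s : nat -> term (PiC C) nat,
    instances K (Psi (est K G)) (cinst s D) & forall v, eval b (s v) = b v.
Proof.
move=> KD Ddef.
pose occ (u : xterm F1 (term Pi nat)) := occurs (eterm (@xargs _ _ u)) D.
pose witness (u : xterm F1 (term Pi nat)) ys :=
  exists xs : 'I_(ar (xhead u)) -> gterm (PiC C),
    [/\ Psi (est K G) (XTerm _ xs), forall i, ys i = gincl nat (xs i) &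
        forall i, gval (xs i) = eval (M := reductl M) b (@xargs _ _ u i)].
(* One tuple of ground terms is fixed per extension term of [D]; [Var 0] is a dummy for terms not
   occurring in [D]. *)
have w u : {ys | occ u -> witness u ys}.
  apply: cid; have [uD|] := pselect (occ u); last by exists (fun=> Var 0).
  have [g Pg /xmap_eq /= [xs eg xsE]] := Ddef _ _ uD.
  by exists (fun i => gincl nat (xs i)) => _; exists xs; rewrite -eg.
(* Each variable takes its value from one chosen occurrence below an extension symbol; a variable
   with no such occurrence stays itself. *)
have S v : {t | (exists u i, [/\ occ u, @xargs _ _ u i = Var v & t = sval (w u) i]) \/
    (t = Var v /\ ~ exists u i, occ u /\ @xargs _ _ u i = Var v)}.
  apply: cid; have [[u [i [uD ui]]]|nv] :=
    pselect (exists u i, occ u /\ @xargs _ _ u i = Var v).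
    by exists (sval (w u) i); left; exists u, i.
  by exists (Var v); right.
pose s v := sval (S v).
have sP v : s v = Var v \/ exists g i, Psi (est K G) g /\
    s v = gincl nat (@xargs _ _ g i) /\ gval (@xargs _ _ g i) = b v.
  rewrite /s; case: (S v) => t /= [[u [i [uD ui ->]]]|[-> _]]; [right|by left].
  have [xs [Pxs xsE bE]] := svalP (w u) uD.
  by exists (XTerm _ xs), i; rewrite xsE bE ui.
(* The choices must be coherent: the variables of [u] may have received their values from the
   witness of another term. *)
have key u : occ u -> exists2 xs : 'I_(ar (xhead u)) -> gterm (PiC C),
    Psi (est K G) (XTerm _ xs) & forall i, inst s (@xargs _ _ u i) = gincl nat (xs i).
  move=> uD.
  have [e|/existsNP[i ne]] :=
      pselect (forall i, inst s (@xargs _ _ u i) = sval (w u) i).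
    have [xs [Pxs xsE _]] := svalP (w u) uD.
    by exists xs => // i; rewrite e.
  have [v ui] := K_flat KD uD i.
  rewrite ui /= in ne.
  have [[u' [j [u'D u'j sv]]]|[_ []]] := svalP (S v); last by exists u, i.
  have vu : subterm (Var v) (eterm (@xargs _ _ u)).
    by apply: (@Sub_arg Pi _ _ (inr (xhead u)) _ i); rewrite ui; apply: Sub_refl.
  have vu' : subterm (Var v) (eterm (@xargs _ _ u')).
    by apply: (@Sub_arg Pi _ _ (inr (xhead u')) _ j); rewrite u'j; apply: Sub_refl.
  (* If the terms coincide, linearity forces the same position, contradicting [ne]. Otherwise both
     heads are unary, and [Pc] moves the chosen argument from the head of [u'] to that of [u]. *)
  have [/eterm_inj eu|[_ ar1 ar1' Pc]] := Psi_shared (est K G) KD uD u'D vu vu'.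
    case: u' / eu j u'j sv {u'D vu'} => j uj sv.
    by case: ne; rewrite /s sv (K_norep KD uD ui uj).
  have [xs [Pxs xsE _]] := svalP (w u') u'D.
  have ord1 n (k l : 'I_n) : n = 1 -> k = l.
    by move=> n1; apply/val_inj; case: k l => [k kn] [l ln] /=; move: kn ln;
      rewrite n1 !ltnS !leqn0 => /eqP -> /eqP ->.
  exists (fun=> xs j).
    apply/Pc; suff -> : (fun=> xs j) = xs by [].
    by apply/funext => k; rewrite (ord1 _ k j ar1').
  by move=> k; rewrite (ord1 _ k i ar1) ui /= /s sv xsE.
exists s; last first.
  move=> v; have [->//|[g [i [_ [-> <-]]]]] := sP v.
  exact: eval_gincl.
(* An extension term of the instance either instantiates one of [D], handled by [key], or is nested
   in a substituted ground term, handled by [psi_est_arg]. *)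
exists D => //; exists s => // u /occurs_cinst[[u0 u0D ->]|[v _ uv]].
  have [xs Pxs xsE] := key _ u0D.
  exists (XTerm _ xs) => //; case: u0 xs xsE {u0D Pxs} => f ts xs /= xsE.
  by rewrite (xmap_args (ys := fun i => gincl nat (xs i)) xsE).
have [e|[g [i [Pg [e _]]]]] := sP v; rewrite {}e in uv.
  by have := subterm_inv uv.
have [t ti /etermC_gincl[g' et eu]] := subterm_gincl uv.
by exists g' => //; apply: (psi_est_arg Psi_closure K_flat Pg); rewrite -et; exact: ti.
Qed.

Lemma weak_model_est_restrict (D : clause Pi P nat) :
  (forall D', instances K (Psi (est K G)) D' -> csat M D') ->
  K D -> weak_model est_restrict D.
Proof.
move=> KM KD b; apply: wsat_prestrict => Ddef.
have [s sI sE] := ground_substitution KD Ddef.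
have := KM _ sI b; rewrite csat_cinst.
by rewrite (_ : (fun v => _) = b) //; apply/funext.
Qed.

Lemma PMod_est_restrict (T0 : theory F0 P) :
  models (reductl (reductl M)) T0 ->
  (forall D, instances K (Psi (est K G)) D -> csat M D) ->
  PMod T0 K Psi est_restrict.
Proof.
move=> MT0 MK; split.
- by exists (fun f xs => @fint _ _ M (inl (inl f)) xs).
- by move=> D; apply: weak_model_est_restrict.
- by rewrite Def_prestrict; apply: psi_gdefined.
Qed.

(** * Transfer of G along a weak embedding *)

Context (B : structure Pi P) (h : est_restrict -> B).
Hypothesis h_hom : weak_hom (B := partial_of B) h.

Definition with_constants : structure (PiC C) P :=
  Structure (carrier_inh B)
    (fun f : PiC C =>
       match f return ('I_(@ar (PiC C) f) -> B) -> B with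
       | inl f => @fint _ _ B f
       | inr c => fun=> h (gval (xcst F0 F1 void c))
       end)
    (@pint _ _ B).

(** Membership of the extension subterms in [est K G] makes every application defined in
    [est_restrict], so [h_hom] applies at each node. *)
Lemma eval_with_constants (b : void -> with_constants) (t : gterm (PiC C)) :
  (forall u : xterm F1 (gterm (PiC C)), subterm (etermC u) t -> est K G u) ->
  eval b t = h (gval t).
Proof.
elim: t => [[]|f ts IH] tG.
have {}IH i : eval b (ts i) = h (gval (ts i)).
  by apply: IH => u ui; apply: tG; apply: Sub_arg ui.
rewrite /= (_ : (fun i => _) = h \o (gval \o ts)); last by apply/funext.
case: f ts {IH} tG => [f|c] ts tG; last first.
  (* A constant has an empty argument tuple, and any two such tuples are equal. *)
  congr (h (gval (App _ _))); apply/funext => i.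
  by case: (notF (ltn_ord i)).
suff e : @pfint _ _ est_restrict f (gval \o ts) = Some (gval (@App (PiC C) void (inl f) ts)).
  by have [] := h_hom e.
case: f ts tG => [//|f] ts tG /=.
rewrite asboolT //; exists (XTerm f ts); last exact: xmap_args.
by apply: (psi_sub Psi_closure); apply: tG; apply: Sub_refl.
Qed.

Hypothesis h_inj : injective h.
Hypothesis h_rel : forall (p : P) (xs : 'I_(ar p) -> est_restrict),
  ppint xs <-> @ppint _ _ (partial_of B) p (h \o xs).

(** Negative literals need truth reflected from [B] back to [M]: injectivity does this for
    equations, [h_rel] for predicates. *)
Lemma csat_with_constants (D : clause (PiC C) P void) :
  List.In D G -> csat M D -> csat with_constants D.
Proof.
move=> DG MD b; have [l lD lM] := MD (of_void M); exists l => //.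
have hE t : atom_term l.2 t -> eval b t = h (gval t).
  move=> tl; apply: eval_with_constants => u ut.
  by left; exists D => //; exists l, t.
suff e : asat b l.2 <-> asat (of_void M) l.2.
  by move: lM; rewrite /lsat; case: l.1 => [/e|nl /e].
case: l.2 hE => [t u|p ts] /= hE.
  rewrite (hE t (or_introl erefl)) (hE u (or_intror erefl)).
  by split=> [/h_inj|tu]; last congr h.
rewrite (_ : (fun i => eval b (ts i)) = h \o (gval \o ts)).
  by split=> /h_rel.
by apply/funext => i; apply: hE; exists i.
Qed.

End Locality.

Theorem theorem6 (F0 F1 P : symbols) (C : Type)
    (T0 : theory F0 P) (K : set (clause (Pi F0 F1) P nat))
    (Psi : forall X : Type, set (xterm F1 X) -> set (xterm F1 X))
    (K_flat : flat K)
    (K_norep : no_repeated_variable K)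
    (Psi_closure : term_closure K Psi)
    (Psi_shared : shared_variables K Psi) :
  Emb T0 K Psi -> Loc T0 K Psi C.
Proof.
move=> emb G; split; apply: contra_not => -[M [MT0 MK MG]].
  (* From a model of the instances to a model of all of [K]: the direction that uses the
     embedding. *)
  have [B [BT0 BK] [h [h_hom h_inj h_rel]]] := emb _
    (PMod_est_restrict K_flat K_norep Psi_closure Psi_shared MT0 MK).
  exists (with_constants h); split=> // [_ [D KD <-]|D DG].
    by apply/csat_clift; exact: BK.
  exact: (csat_with_constants Psi_closure h_hom h_inj h_rel DG (MG D DG)).
(* Conversely, a model of [K] satisfies every instance of its clauses. *)
exists M; split=> // _ [D KD [s -> _]] b.
have /csat_clift DM := MK _ (ex_intro2 _ _ D KD erefl).
by apply/csat_cinst.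
Qed.
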